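(* Consider the Lie algebra of type $G_2$. Let $\ell\ge 1$ be an integer, $\lambda=\ell\varpi_2$, and $\mu=m_1\varpi_1+m_2\varpi_2$ with $m_1,m_2$ nonnegative integers satisfying $3\ell-1=2m_1+3m_2$. Write $m_1=3n+1$ (with $n$ a nonnegative integer). Then $m_q(\lambda,\mu)=q^{n+2}$.
   Context: Type $G_2$: simple roots $\alpha_1$ (short), $\alpha_2$ (long); positive roots $\alpha_1,\alpha_2,\alpha_1+\alpha_2,2\alpha_1+\alpha_2,3\alpha_1+\alpha_2,3\alpha_1+2\alpha_2$; $\varpi_1=2\alpha_1+\alpha_2$, $\varpi_2=3\alpha_1+2\alpha_2$, $\rho=\varpi_1+\varpi_2$. $W$ is the Weyl group generated by simple reflections $s_1,s_2$, and $\mathrm{len}(\sigma)$ is the length. For a weight $\xi$, $\wp_q(\xi)=\sum_{j\ge0}c_jq^j$, where $c_j$ is the number of ways to write $\xi$ as a nonnegative integral sum of exactly $j$ positive roots. The $q$-multiplicity is $m_q(\lambda,\mu)=\sum_{\sigma\in W}(-1)^{\mathrm{len}(\sigma)}\wp_q(\sigma(\lambda+\rho)-(\mu+\rho))$. *)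

(* Defs.v *)
From HB Require Import structures.
From mathcomp Require Import all_boot all_order all_algebra.
From mathcomp Require Import boolp classical_sets cardinality fsbigop.
From mathcomp Require Import ring.

Set Implicit Arguments.
Unset Strict Implicit.
Unset Printing Implicit Defensive.

Import Order.TTheory GRing.Theory Num.Theory.
Local Open Scope ring_scope.

Module G2.

(* A weight is the column of its coordinates in the basis (alpha1, alpha2) of
   simple roots; in type G2 the root lattice is the whole weight lattice. *)
Definition weight := 'cV[int]_2.

Definition simple (i : 'I_2) : weight := delta_mx i 0.
Definition alpha1 : weight := simple 0.
Definition alpha2 : weight := simple 1.

Definition posroots : 6.-tuple weight :=
  [tuple alpha1; alpha2; alpha1 + alpha2; alpha1 *+ 2 + alpha2;
         alpha1 *+ 3 + alpha2; alpha1 *+ 3 + alpha2 *+ 2].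

Definition varpi1 : weight := alpha1 *+ 2 + alpha2.
Definition varpi2 : weight := alpha1 *+ 3 + alpha2 *+ 2.
Definition rho : weight := varpi1 + varpi2.

(* The linear form <-, alpha_i^vee>; alpha1 is short, alpha2 is long, so
   <alpha2, alpha1^vee> = -3 and <alpha1, alpha2^vee> = -1. *)
Definition coroot (i : 'I_2) : 'rV[int]_2 :=
  \row_j (if i == j then 2 else if i == 0 then -3 else -1).

(* s_i xi = xi - <xi, alpha_i^vee> alpha_i; matrices act on weights by *m. *)
Definition refl (i : 'I_2) : 'M[int]_2 := 1 - simple i *m coroot i.

Definition word_prod (w : seq 'I_2) : 'M[int]_2 := \prod_(i <- w) refl i.

(* Words without inverses suffice, as each s_i is an involution. *)
Definition weyl : set 'M[int]_2 :=
  [set sigma | exists w : seq 'I_2, word_prod w = sigma]%classic.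

Definition is_length (sigma : 'M[int]_2) (k : nat) : Prop :=
  (exists2 w, word_prod w = sigma & size w = k) /\
  (forall w, word_prod w = sigma -> (k <= size w)%N).

Definition len (sigma : 'M[int]_2) : nat :=
  xget 0%N [set k | is_length sigma k]%classic.

(* The multiplicity k b of each positive root is at most the number j of roots
   used, hence the codomain 'I_j.+1. *)
Definition npart (j : nat) (xi : weight) : nat :=
  #|[pred k : {ffun 'I_6 -> 'I_j.+1} |
      ((\sum_b (k b : nat))%N == j) &&
      (\sum_b tnth posroots b *+ k b == xi)]|.

Definition q : {poly int} := 'X.

Definition qpart (xi : weight) : {poly int} :=
  \sum_(j \in [set: nat]%classic) q ^+ j *+ npart j xi.

Definition qmult (lambda mu : weight) : {poly int} :=
  \sum_(sigma \in weyl)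
    (-1) ^+ len sigma * qpart (sigma *m (lambda + rho) - (mu + rho)).

(* Sums over infinite index sets default to 0 when the support is infinite;
   the next facts show that no default value is ever used. *)
Lemma refl_invol i : refl i * refl i = 1.
Proof.
apply/matrixP => a b; rewrite !mxE !big_ord_recl big_ord0 !mxE.
rewrite !big_ord_recl !big_ord0 !mxE.
by case: i a b => [[|[|//]] ?] [[|[|//]] ?] [[|[|//]] ?].
Qed.

Lemma lenP sigma : weyl sigma -> is_length sigma (len sigma).
Proof.
move=> [w0 w0E].
have exP : exists k, `[< exists2 w, word_prod w = sigma & size w = k >].
  by exists (size w0); apply/asboolP; exists w0.
rewrite /len; case: xgetP => [k _ //|/(_ (ex_minn exP)) nP].
exfalso; apply: nP; case: ex_minnP => k /asboolP kP kmin; split=> // w wE.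
by apply: kmin; apply/asboolP; exists w.
Qed.

Lemma posroots_height b : 1 <= tnth posroots b 0 0 + tnth posroots b 1 0.
Proof.
by case: b => [[|[|[|[|[|[|//]]]]]] ?]; rewrite (tnth_nth 0) /= !mxE.
Qed.

Lemma npart_eq0 j (xi : weight) : xi 0 0 + xi 1 0 < j%:Z -> npart j xi = 0%N.
Proof.
move=> ltj; apply: eq_card0 => k; rewrite !inE.
apply/negP => /andP[/eqP sj /eqP xiE]; move: ltj; rewrite ltNge => /negP; apply.
rewrite -xiE !summxE -big_split /= -[X in X%:Z]sj -natz natr_sum.
apply: ler_sum => b _; rewrite !mulmxnE -mulrnDl.
by rewrite lerMn2r posroots_height orbT.
Qed.

Lemma finite_npart (xi : weight) :
  finite_set [set j | npart j xi != 0%N]%classic.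
Proof.
apply: (@sub_finite_set _ _ [set` iota 0 `|xi 0 0 + xi 1 0|.+1]%classic);
  last exact: finite_seq.
move=> j /eqP h; rewrite /mkset mem_iota /= add0n ltnS.
rewrite leqNgt; apply/negP => lt; apply: h; apply: npart_eq0.
by apply: le_lt_trans (ler_norm _) _; rewrite -abszE ltz_nat.
Qed.

Definition mx4 (t : int * int * int * int) : 'M[int]_2 :=
  let: (a, b, c, d) := t in
  \matrix_(i, j) if i == 0 then (if j == 0 then a else b)
                 else (if j == 0 then c else d).

Definition refl4 (i : bool) (t : int * int * int * int) :=
  let: (a, b, c, d) := t in
  if i then (- a + 3 * c, - b + 3 * d, c, d) else (a, b, a - c, b - d).

Lemma refl_mx4 i t : refl i * mx4 t = mx4 (refl4 (i == 0) t).
Proof.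
case: t => [[[a b] c] d]; apply/matrixP => x y.
rewrite !mxE !big_ord_recl big_ord0 !mxE !big_ord_recl !big_ord0 !mxE.
case: i x y => [[|[|//]] ?] [[|[|//]] ?] [[|[|//]] ?] /=;
  rewrite mxE /=; ring.
Qed.

Definition weyl4 : seq (int * int * int * int) :=
  let g n := iter n (fun t => refl4 true (refl4 false t)) (1, 0, 0, 1) in
  [seq g n | n <- iota 0 6] ++ [seq refl4 true (g n) | n <- iota 0 6].

Lemma finite_weyl : finite_set weyl.
Proof.
apply: (@sub_finite_set _ _ [set` map mx4 weyl4]%classic);
  last exact: finite_seq.
move=> _ [w <-]; rewrite /mkset /word_prod; elim: w => [|i w].
  rewrite big_nil; apply/mapP; exists (1, 0, 0, 1) => //.
  apply/matrixP => x y; rewrite !mxE.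
  by case: x y => [[|[|//]] ?] [[|[|//]] ?].
rewrite big_cons => /mapP[t tW ->]; rewrite refl_mx4; apply: map_f.
have /allP/(_ t tW) : all (fun t => (refl4 true t \in weyl4) && (refl4 false t \in weyl4)) weyl4.
  by vm_compute.
by case/andP; case: (i == 0).
Qed.

End G2.

(* Main.v *)
Require Import Defs.
From mathcomp Require Import all_boot all_order all_algebra.
From mathcomp Require Import classical_sets fsbigop.
From mathcomp Require Import zify.
Import Order.TTheory GRing.Theory Num.Theory.
Local Open Scope ring_scope.

(** In simple root coordinates lambda - mu = (1, n + 1), and for every Weyl group
    element sigma other than 1 and s_1 the weight sigma (lambda + rho) - (mu + rho)
    has a negative coordinate.  Hence m_q(lambda, mu) is
    wp_q(alpha1 + (n + 1) alpha2) - wp_q((n + 1) alpha2)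
      = (q^(n + 1) + q^(n + 2)) - q^(n + 1). *)

Import G2.

(** The multiplicities range over [nat], without the bound ['I_j.+1] of [npart], so that linear
    arithmetic applies to them directly. *)
Definition is_partition (j : nat) (xi : weight) (k : 'I_6 -> nat) : Prop :=
  (\sum_b k b)%N = j /\ \sum_b tnth posroots b *+ k b = xi.

Lemma weightP (x y : weight) : x 0 0 = y 0 0 -> x 1 0 = y 1 0 -> x = y.
Proof.
move=> h0 h1; apply/colP => -[[|[|//]] i].
  by have -> : Ordinal i = 0 by apply: val_inj.
by have -> : Ordinal i = 1 by apply: val_inj.
Qed.

(** Comparing coordinates in the simple roots turns a partition into a linear system over the
    naturals, within reach of [lia]. Through [inord], [k'] reads [k] at numerals, in the order of
    [posroots]. *)
Lemma is_partitionE (j a b : nat) (k : 'I_6 -> nat) (k' := fun i => k (inord i)) :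
  is_partition j (alpha1 *+ a + alpha2 *+ b) k <->
  [/\ (k' 0 + k' 1 + k' 2 + k' 3 + k' 4 + k' 5 = j)%N,
      (k' 0 + k' 2 + 2 * k' 3 + 3 * k' 4 + 3 * k' 5 = a)%N &
      (k' 1 + k' 2 + k' 3 + k' 4 + 2 * k' 5 = b)%N].
Proof.
have kE (i : 'I_6) : k i = k' i by rewrite /k' inord_val.
have sumE : (\sum_b k b = k' 0 + k' 1 + k' 2 + k' 3 + k' 4 + k' 5)%N.
  by rewrite !big_ord_recl big_ord0 !kE /= /bump /= !add1n; lia.
have coordE (c : 'I_2) : (\sum_b tnth posroots b *+ k b : weight) c 0%R =
    (if c == 0%R then k' 0 + k' 2 + 2 * k' 3 + 3 * k' 4 + 3 * k' 5
     else k' 1 + k' 2 + k' 3 + k' 4 + 2 * k' 5)%N :> int.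
  rewrite summxE !big_ord_recl big_ord0 !kE /= /bump /= !add1n.
  rewrite !(tnth_nth 0) /= !mulmxnE.
  by case: c => [[|[|//]] ?]; rewrite !mxE ?mulmxnE ?mxE /=; lia.
have abE (c : 'I_2) : (alpha1 *+ a + alpha2 *+ b : weight) c 0%R =
    (if c == 0%R then a else b) :> int.
  by rewrite mxE !mulmxnE !mxE; case: c => [[|[|//]] ?] /=; lia.
rewrite /is_partition sumE; split=> [[sj] /colP h|[sj ha hb]].
  by move: (h 0) (h 1); rewrite !coordE !abE /= => -[<-] [<-].
by split=> //; apply: weightP; rewrite coordE abE /= ?ha ?hb.
Qed.

Lemma npart_none (j : nat) (xi : weight) :
  (forall k, ~ is_partition j xi k) -> npart j xi = 0%N.
Proof.
move=> no; apply: eq_card0 => k; rewrite !inE; apply/negP.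
by case/andP => /eqP h1 /eqP h2; apply: (no (fun b => k b)).
Qed.

Lemma npart_unique (j : nat) (xi : weight) (c : 'I_6 -> nat) :
  (forall k, is_partition j xi k <-> k =1 c) -> npart j xi = 1%N.
Proof.
move=> uniq_c; have [cj cxi] : is_partition j xi c by apply/uniq_c.
(* A multiplicity never exceeds the total number [j] of parts, so [c] lives in the bounded function
   type counted by [npart]. *)
have cle b : (c b < j.+1)%N by rewrite ltnS -cj (bigD1 b) //= leq_addr.
rewrite -(card1 [ffun b => Ordinal (cle b)]); apply: eq_card => k.
rewrite !inE; apply/andP/eqP => [[/eqP h1 /eqP h2]|->].
  have /uniq_c kc : is_partition j xi (fun b => k b) by [].
  by apply/ffunP => b; rewrite ffunE; apply/val_inj/kc.
split; apply/eqP.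
  by rewrite -[RHS]cj; apply: eq_bigr => b _; rewrite ffunE.
by rewrite -[RHS]cxi; apply: eq_bigr => b _; rewrite ffunE.
Qed.

Lemma eqfun_inord6 (k c : 'I_6 -> nat) :
  [/\ k (inord 0) = c (inord 0), k (inord 1) = c (inord 1),
      k (inord 2) = c (inord 2), k (inord 3) = c (inord 3) &
      k (inord 4) = c (inord 4) /\ k (inord 5) = c (inord 5)] -> k =1 c.
Proof.
case=> h0 h1 h2 h3 [h4 h5] i; rewrite -[i]inord_val.
by case: i => [[|[|[|[|[|[|//]]]]]] ?] /=.
Qed.

(** Every positive root other than [alpha2] involves [alpha1], so the only partition uses [n] copies
    of [alpha2]. *)
Lemma npart_alpha2 (j n : nat) : npart j (alpha2 *+ n) = (j == n).
Proof.
rewrite -[alpha2 *+ n]add0r -(mulr0n alpha1).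
have [->|neq_jn] := eqVneq j n; last first.
  by apply: npart_none => k /is_partitionE[]; lia.
(* The list holds multiplicities in the order of [posroots]; the default value 0 of [nth] covers the
   roots left out. *)
apply: (@npart_unique _ _ (nth 0 [:: 0; n])%N) => k; rewrite is_partitionE.
split=> [[*]|kE]; last by rewrite !kE !inordK //=; split; lia.
by apply: eqfun_inord6; rewrite !inordK //=; split; lia.
Qed.

(** Exactly one part involves [alpha1], with coefficient 1: it is [alpha1 + alpha2], completed by
    [n] copies of [alpha2], or [alpha1], completed by [n.+1] copies. *)
Lemma npart_alpha1_alpha2 (j n : nat) :
  npart j (alpha1 + alpha2 *+ n.+1) = ((j == n.+1) + (j == n.+2))%N.
Proof.
rewrite -(mulr1n alpha1).
have [->|neq_j1] := eqVneq j n.+1.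
  rewrite eqn_leq ltnn andbF.
  apply: (@npart_unique _ _ (nth 0 [:: 0; n; 1])%N) => k; rewrite is_partitionE.
  split=> [[*]|kE]; last by rewrite !kE !inordK //=; split; lia.
  by apply: eqfun_inord6; rewrite !inordK //=; split; lia.
have [->|neq_j2] := eqVneq j n.+2; last first.
  by apply: npart_none => k /is_partitionE[]; lia.
apply: (@npart_unique _ _ (nth 0 [:: 1; n.+1])%N) => k; rewrite is_partitionE.
split=> [[*]|kE]; last by rewrite !kE !inordK //=; split; lia.
by apply: eqfun_inord6; rewrite !inordK //=; split; lia.
Qed.

(** Positive roots have nonnegative coordinates, hence so do their sums. *)
Lemma npart_neg (j : nat) (xi : weight) :
  (xi 0 0 < 0) || (xi 1 0 < 0) -> npart j xi = 0%N.
Proof.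
move=> neg; apply: npart_none => k [_ xiE].
have ge0 c : 0 <= xi c 0.
  rewrite -xiE summxE; apply: sumr_ge0 => b _; rewrite mulmxnE mulrn_wge0 //.
  by case: b => [[|[|[|[|[|[|//]]]]]] ?]; rewrite (tnth_nth 0) /= !mxE;
    case: c => [[|[|//]] ?].
by move: neg; rewrite !ltNge !ge0.
Qed.

Lemma qpart_neg (xi : weight) : (xi 0 0 < 0) || (xi 1 0 < 0) -> qpart xi = 0.
Proof. by move=> neg; apply: fsbig1 => j _; rewrite npart_neg. Qed.

(** Trades the sum over all naturals for a list sum that can be unfolded term by term. *)
Lemma qpart_widen (s : seq nat) (xi : weight) : uniq s ->
  (forall j, j \notin s -> npart j xi = 0%N) ->
  qpart xi = \sum_(j <- s) q ^+ j *+ npart j xi.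
Proof.
move=> us h; rewrite fsbig_seq // /qpart; apply/esym/fsbig_widen => //.
by move=> j [_ /negP js]; rewrite /= h.
Qed.

Lemma qpart_alpha2 (n : nat) : qpart (alpha2 *+ n) = q ^+ n.
Proof.
rewrite (@qpart_widen [:: n]) ?big_seq1 ?npart_alpha2 ?eqxx // => j.
by rewrite inE npart_alpha2 => /negPf ->.
Qed.

Lemma qpart_alpha1_alpha2 (n : nat) :
  qpart (alpha1 + alpha2 *+ n.+1) = q ^+ n.+1 + q ^+ n.+2.
Proof.
rewrite (@qpart_widen [:: n.+1; n.+2]) => [|/=|j].
- rewrite big_cons big_seq1 !npart_alpha1_alpha2 !eqxx.
  by rewrite !eqn_leq !ltnn andbF.
- by rewrite inE; lia.
- by rewrite !inE npart_alpha1_alpha2 negb_or => /andP[/negPf -> /negPf ->].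
Qed.

Lemma mx4_1 : mx4 (1, 0, 0, 1) = 1.
Proof.
by apply/matrixP => x y; rewrite !mxE; case: x y => [[|[|//]] ?] [[|[|//]] ?].
Qed.

Lemma refl0E : refl 0 = mx4 (-1, 3, 0, 1).
Proof. by rewrite -[LHS]mulr1 -mx4_1 refl_mx4. Qed.

(** Induction on the word: [weyl4] contains the identity and is stable under left multiplication by
    both simple reflections. *)
Lemma weyl_mx4 (sigma : 'M[int]_2) : weyl sigma ->
  exists2 t, t \in weyl4 & sigma = mx4 t.
Proof.
case=> w <-; rewrite /word_prod; elim: w => [|i w [t tW IH]].
  by exists (1, 0, 0, 1); rewrite // big_nil mx4_1.
exists (refl4 (i == 0) t); last by rewrite big_cons IH refl_mx4.
have /allP/(_ t tW)/andP[] : all (fun t =>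
  (refl4 true t \in weyl4) && (refl4 false t \in weyl4)) weyl4 by vm_compute.
by case: (i == 0).
Qed.

Lemma weyl1 : weyl 1.
Proof. by exists [::]; rewrite /word_prod big_nil. Qed.

Lemma weyl_refl (i : 'I_2) : weyl (refl i).
Proof. by exists [:: i]; rewrite /word_prod big_seq1. Qed.

Lemma refl0_neq1 : refl 0 != 1.
Proof. by apply/eqP => /matrixP/(_ 0 0); rewrite refl0E !mxE. Qed.

Lemma len1 : len 1 = 0%N.
Proof.
have [_ /(_ [::])] := lenP weyl1.
by rewrite /word_prod big_nil leqn0 => /(_ erefl)/eqP.
Qed.

(** The one-letter word bounds the length by 1, and the empty word gives the identity, which differs
    from [refl 0]. *)
Lemma len_refl0 : len (refl 0) = 1%N.
Proof.
have [[w wE <-] /(_ [:: 0])] := lenP (weyl_refl 0).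
rewrite /word_prod big_seq1 => /(_ erefl).
case: w wE => [|i [|//]] //; rewrite /word_prod big_nil => /esym/eqP.
by rewrite (negPf refl0_neq1).
Qed.

Theorem theorem1p6 (l m1 m2 : nat) (hl : (1 <= l)%N)
    (hlm : (3 * l - 1 = 2 * m1 + 3 * m2)%N) :
  exists2 n : nat, (m1 = 3 * n + 1)%N &
    G2.qmult (G2.varpi2 *+ l) (G2.varpi1 *+ m1 + G2.varpi2 *+ m2)
      = G2.q ^+ (n + 2).
Proof.
pose n := (m1 %/ 3)%N.
(* Modulo 3, [hlm] says that 2 * [m1] is -1, so [m1] is 1; [hl] keeps the subtraction in [nat] from
   truncating. *)
have m1E : (m1 = 3 * n + 1)%N by rewrite /n; lia.
exists n => //; have lE : (l = 2 * n + 1 + m2)%N by lia.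
move: (n) m1E lE => {}n -> ->; clear.
set lambda := varpi2 *+ _; set mu := _ + _.
(* Since [varpi2] is (3, 2) and [rho] is (5, 3), [x] and [y] are the coordinates of [lambda + rho];
   the subtracted constants are those of [mu + rho]. *)
have coordE t (d := mx4 t *m (lambda + rho) - (mu + rho)) :
  let: (a, b, c, e) := t in
  let x := (3 * (2 * n + 1 + m2) + 5)%N%:Z in
  let y := (2 * (2 * n + 1 + m2) + 3)%N%:Z in
  d 0 0 = a * x + b * y - (6 * n + 3 * m2 + 7)%N%:Z /\
  d 1 0 = c * x + e * y - (3 * n + 2 * m2 + 4)%N%:Z.
  case: t @d => [[[a b] c] e] /=.
  rewrite /lambda /mu /rho /varpi1 /varpi2.
  rewrite !mxE !big_ord_recl !big_ord0 /= !(mulmxnE, mxE) /=.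
  split; lia.
rewrite /qmult (_ : \sum_(_ \in _) _ = \sum_(sigma <- [:: 1; refl 0])
  (-1) ^+ len sigma * qpart (sigma *m (lambda + rho) - (mu + rho))); last first.
  rewrite [RHS]fsbig_seq; last by rewrite /= inE eq_sym refl0_neq1.
  apply/esym/fsbig_widen => /= [s|s [/weyl_mx4[t tW ->]]].
    by rewrite /= !inE => /orP[]/eqP->; [apply: weyl1|apply: weyl_refl].
  (* Writing both exceptional elements as [mx4] of a quadruple turns distinct matrices into distinct
     quadruples, which can be filtered by computation. *)
  rewrite /= !inE refl0E -mx4_1 => /negP; rewrite negb_or => /andP[t1 t2].
  rewrite qpart_neg ?mulr0 //.
  have {t1 t2} : t \in [seq t <- weyl4 |
      (t != (1, 0, 0, 1)) && (t != (-1, 3, 0, 1))].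
    rewrite mem_filter tW andbT; apply/andP; split.
      by apply: contraNneq t1 => ->.
    by apply: contraNneq t2 => ->.
  have := coordE t; move: (mx4 t *m _ - _) => d.
  (* Evaluation lists the ten remaining elements; for each, [lia] finds a negative coordinate. *)
  set r := filter _ _; vm_compute in (value of r); rewrite {}/r !inE.
  case: t {tW} => [[[a b] c] e] /= [-> ->].
  by do ![case/orP] => /eqP[-> -> -> ->]; lia.
rewrite big_cons big_seq1 len1 len_refl0 expr0 expr1 mul1r mulN1r.
have [] := coordE (1, 0, 0, 1); have [] := coordE (-1, 3, 0, 1).
rewrite -refl0E mx4_1 => h0 h1 h2 h3.
have -> : 1 *m (lambda + rho) - (mu + rho) = alpha1 + alpha2 *+ n.+1.
  by apply: weightP; rewrite ?h2 ?h3 !mxE ?mulmxnE ?mxE /=; lia.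
have -> : refl 0 *m (lambda + rho) - (mu + rho) = alpha2 *+ n.+1.
  by apply: weightP; rewrite ?h0 ?h1 mulmxnE !mxE /=; lia.
by rewrite qpart_alpha1_alpha2 qpart_alpha2 addrC addKr addn2.
Qed.
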